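(* Let $I\subseteq\mathbb R$ be an open interval, let $\mathbf A:I\to\mathbb H^{n\times n}$ and $\mathbf b:I\to\mathbb H^{1\times n}$ be continuous, and let $\mathbf X_l$ be a fundamental matrix of the homogeneous left system $\mathbf x'=\mathbf x\mathbf A(t)$. Then the general solution of the nonhomogeneous left system $\mathbf x'=\mathbf x\mathbf A(t)+\mathbf b(t)$ is given by $$\mathbf x^{NH}_{gen}(t)=\mathbf q\,\mathbf X_l(t)+\left(\int_{t_0}^{t}\mathbf b(s)\mathbf X_l^{-1}(s)\,ds\right)\mathbf X_l(t),$$ where $t_0\in I$ and $\mathbf q\in\mathbb H^{1\times n}$ is a constant (arbitrary) quaternionic row vector.
   Context: $\mathbb H$ is the real quaternion skew field; derivatives and integrals with respect to the real variable are taken componentwise (entrywise). Solutions are row-vector functions. A fundamental matrix $\mathbf X_l(t)$ of $\mathbf x'=\mathbf x\mathbf A(t)$ is a matrix whose rows $\mathbf x_1(t),\dots,\mathbf x_n(t)$ are solutions of this system that are left linearly independent on $I$ (no constants $q_1,\dots,q_n\in\mathbb H$, not all zero, satisfy $\sum_iq_i\mathbf x_i(t)=\mathbf 0$ for all $t\in I$). ''General solution'' means that the functions of the displayed form, as $\mathbf q$ ranges over $\mathbb H^{1\times n}$, are exactly the solutions of the system on $I$. *)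

(* Defs.v *)
From HB Require Import structures.
From mathcomp Require Import all_boot all_order all_algebra.
From mathcomp Require Import all_classical all_reals all_analysis.
From mathcomp Require Import ring.

Set Implicit Arguments.
Unset Strict Implicit.
Unset Printing Implicit Defensive.

Import Order.TTheory GRing.Theory Num.Theory.
Import numFieldNormedType.Exports.

Local Open Scope classical_set_scope.
Local Open Scope ring_scope.

Record quat (R : Type) : Type :=
  Quat { qre : R; qim_i : R; qim_j : R; qim_k : R }.

Section Quaternions.
Variable R : realType.
Implicit Types p q : quat R.

Definition quat_tuple q : R * R * R * R := (qre q, qim_i q, qim_j q, qim_k q).
Definition tuple_quat (u : R * R * R * R) : quat R :=
  Quat u.1.1.1 u.1.1.2 u.1.2 u.2.

Lemma quat_tupleK : cancel quat_tuple tuple_quat.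
Proof. by case. Qed.

HB.instance Definition _ := Choice.copy (quat R) (can_type quat_tupleK).

Definition addq p q : quat R :=
  Quat (qre p + qre q) (qim_i p + qim_i q) (qim_j p + qim_j q)
       (qim_k p + qim_k q).

Definition oppq p : quat R :=
  Quat (- qre p) (- qim_i p) (- qim_j p) (- qim_k p).

(* i^2 = j^2 = k^2 = ijk = -1 *)
Definition mulq p q : quat R :=
  let: Quat a1 b1 c1 d1 := p in
  let: Quat a2 b2 c2 d2 := q in
  Quat (a1 * a2 - b1 * b2 - c1 * c2 - d1 * d2)
       (a1 * b2 + b1 * a2 + c1 * d2 - d1 * c2)
       (a1 * c2 - b1 * d2 + c1 * a2 + d1 * b2)
       (a1 * d2 + b1 * c2 - c1 * b2 + d1 * a2).

Fact addqA : associative addq.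
Proof. by case=> ????; case=> ????; case=> ????; rewrite /addq /= !addrA. Qed.

Fact addqC : commutative addq.
Proof. by case=> ????; case=> ????; congr Quat; rewrite /= addrC. Qed.

Fact add0q : left_id (Quat 0 0 0 0) addq.
Proof. by case=> ????; rewrite /addq /= !add0r. Qed.

Fact addNq : left_inverse (Quat 0 0 0 0) oppq addq.
Proof. by case=> ????; rewrite /addq /= !addNr. Qed.

HB.instance Definition _ :=
  GRing.isZmodule.Build (quat R) addqA addqC add0q addNq.

Fact mulqA : associative mulq.
Proof.
by case=> ????; case=> ????; case=> ????; rewrite /mulq; congr Quat; ring.
Qed.

Fact mul1q : left_id (Quat 1 0 0 0) mulq.
Proof. by case=> ????; rewrite /mulq; congr Quat; ring. Qed.

Fact mulq1 : right_id (Quat 1 0 0 0) mulq.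
Proof. by case=> ????; rewrite /mulq; congr Quat; ring. Qed.

Fact mulqDl : left_distributive mulq +%R.
Proof.
by case=> ????; case=> ????; case=> ????; rewrite /mulq; congr Quat => /=; ring.
Qed.

Fact mulqDr : right_distributive mulq +%R.
Proof.
by case=> ????; case=> ????; case=> ????; rewrite /mulq; congr Quat => /=; ring.
Qed.

Fact oneq_neq0 : Quat 1 0 0 0 != 0 :> quat R.
Proof. by apply/eqP => -[] /eqP; rewrite oner_eq0. Qed.

HB.instance Definition _ := GRing.Zmodule_isNzRing.Build (quat R)
  mulqA mul1q mulq1 mulqDl mulqDr oneq_neq0.

(* The topology of R^4; matrices over quat R then carry the product topology. *)
HB.instance Definition _ :=
  Topological.copy (quat R) (initial_topology quat_tuple).

End Quaternions.

Section Calculus.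
Variable R : realType.

Definition is_qderive (t : R) (f : R -> quat R) (df : quat R) : Prop :=
  [/\ is_derive t 1 (fun s => qre (f s)) (qre df),
      is_derive t 1 (fun s => qim_i (f s)) (qim_i df),
      is_derive t 1 (fun s => qim_j (f s)) (qim_j df) &
      is_derive t 1 (fun s => qim_k (f s)) (qim_k df)].

Definition is_mxderive (m n : nat) (t : R) (F : R -> 'M[quat R]_(m, n))
    (dF : 'M[quat R]_(m, n)) : Prop :=
  forall i j, is_qderive t (fun s => F s i j) (dF i j).

(* The integral from a to b, in either order of a and b. *)
Definition oriented_integral (a b : R) (f : R -> R) : R :=
  if a <= b then \int[lebesgue_measure]_(s in `[a, b]) f s
  else - \int[lebesgue_measure]_(s in `[b, a]) f s.

Definition qintegral (a b : R) (f : R -> quat R) : quat R :=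
  Quat (oriented_integral a b (fun s => qre (f s)))
       (oriented_integral a b (fun s => qim_i (f s)))
       (oriented_integral a b (fun s => qim_j (f s)))
       (oriented_integral a b (fun s => qim_k (f s))).

Definition mxintegral (m n : nat) (a b : R) (F : R -> 'M[quat R]_(m, n)) :
    'M[quat R]_(m, n) :=
  \matrix_(i, j) qintegral a b (fun s => F s i j).

End Calculus.

(* [unitmx] and [invmx] are determinant-based and need commutative coefficients. *)
Section MatrixInverse.
Variables (R : realType) (n : nat).
Implicit Types X Y : 'M[quat R]_n.

Definition is_qinvmx X Y : Prop := X *m Y = 1%:M /\ Y *m X = 1%:M.

Definition qunitmx X : Prop := exists Y, is_qinvmx X Y.

(* 0 when X is not invertible *)
Definition qinvmx X : 'M[quat R]_n := xget 0 [set Y | is_qinvmx X Y].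

End MatrixInverse.

Section LeftSystems.
Variables (R : realType) (n : nat) (I : set R).
Implicit Types (A X : R -> 'M[quat R]_n) (b x : R -> 'rV[quat R]_n).

Definition left_solution A b x : Prop :=
  forall t, I t -> is_mxderive t x (x t *m A t + b t).

Definition left_independent_rows X : Prop :=
  forall q : 'I_n -> quat R,
    (forall t, I t -> \sum_i q i *: row i (X t) = 0) -> forall i, q i = 0.

Definition left_fundamental_matrix A X : Prop :=
  (forall i, left_solution A (fun=> 0) (fun t => row i (X t))) /\
  left_independent_rows X.

End LeftSystems.

(* Main.v *)
Require Import Defs.
From HB Require Import structures.
From mathcomp Require Import all_boot all_order all_algebra.
From mathcomp Require Import all_classical all_reals all_analysis.
From mathcomp Require Import ring lra.

(** The proof is variation of constants, arranged so that the only fact about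
    differential equations that it needs is uniqueness for the homogeneous
    system; no existence theorem is invoked.

    Uniqueness ([homogeneous_solution_eq0]).  For a solution x of x' = xA the
    function |x|^2 is real, nonnegative and satisfies | (|x|^2)' | <= K |x|^2 on
    every compact subinterval, because the quaternion norm is multiplicative and
    A is bounded there.  By Gronwall ([gronwall_eq0_endpoints]) it vanishes at
    one end of such an interval if and only if it vanishes at the other, so a
    solution with one zero in I is zero on I.

    Invertibility of X(s).  If q X(s) = 0 then the solution qX is zero on I, and
    left independence of the rows gives q = 0 ([fundamental_left_cancellable]).
    Right multiplication by X(s) is thus an injective endomorphism of H^(1 x n),
    which is a real vector space of dimension 4n, hence bijective; this gives the
    two-sided inverse ([qinv_cramerP]).  The same real form exhibits the entries
    of the inverse as quotients of polynomials in the real coordinates of X(s) by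
    a real determinant, so the inverse is continuous in s
    ([is_qcontinuous_qinvmx]).

    General solution.  Let w = b X^-1, which is continuous on I, and let W be its
    integral from t0.  Then W' = w by the fundamental theorem of calculus, and
    (WX)' = wX + WXA = b + (WX)A, so WX is a particular solution.  Any other
    solution x differs from it by a homogeneous one; with
    q = x(t0) X(t0)^-1 the function x - WX - qX is a homogeneous
    solution vanishing at t0 (recall W(t0) = 0), hence zero. *)

Set Implicit Arguments.
Unset Strict Implicit.
Unset Printing Implicit Defensive.

Import Order.TTheory GRing.Theory Num.Theory.
Import numFieldNormedType.Exports.

Local Open Scope classical_set_scope.
Local Open Scope ring_scope.

(** * Pointwise calculus of real functions *)

Section PointwiseCalculus.
Context {R : realType}.
Implicit Types (f g : R -> R) (t a b df dg : R).

(* The limit and derivative rules of this section are restatements for lambda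
   terms, so that the unifier matches them against components of quaternion
   products without unfolding the ring of functions. *)

Lemma is_derive_addf t f g df dg : is_derive t 1 f df -> is_derive t 1 g dg ->
  is_derive t 1 (fun s => f s + g s) (df + dg).
Proof. exact: is_deriveD. Qed.

Lemma is_derive_mulf t f g df dg : is_derive t 1 f df -> is_derive t 1 g dg ->
  is_derive t 1 (fun s => f s * g s) (df * g t + f t * dg).
Proof.
move=> fdf gdg; apply: is_derive_eq (is_deriveM fdf gdg) _.
by rewrite /GRing.scale /= addrC mulrC.
Qed.

Lemma is_derive_sumf t (J : finType) (F : J -> R -> R) (dF : J -> R) :
  (forall i, is_derive t 1 (F i) (dF i)) ->
  is_derive t 1 (fun s => \sum_i F i s) (\sum_i dF i).
Proof.
move=> FdF.
have : forall r : seq J,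
    is_derive t 1 (fun s => \sum_(i <- r) F i s) (\sum_(i <- r) dF i).
  elim=> [|i r IH].
    by under eq_fun do rewrite big_nil; rewrite big_nil; exact: is_derive_cst.
  by under eq_fun do rewrite big_cons; rewrite big_cons; exact: is_derive_addf.
exact.
Qed.

Lemma is_derive1_subc f t l c : derivable f t 1 -> f^`()%classic t = l ->
  is_derive t 1 (fun s => f s - c) l.
Proof.
move=> df <-; rewrite derive1E -[X in is_derive _ _ _ X]subr0.
exact: is_deriveB (derivableP df) (is_derive_cst c t 1).
Qed.

Lemma cvg_addf t f g a b : f s @[s --> t] --> a -> g s @[s --> t] --> b ->
  f s + g s @[s --> t] --> a + b.
Proof. exact: cvgD. Qed.

Lemma cvg_subf t f g a b : f s @[s --> t] --> a -> g s @[s --> t] --> b ->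
  f s - g s @[s --> t] --> a - b.
Proof. exact: cvgB. Qed.

Lemma cvg_mulf t f g a b : f s @[s --> t] --> a -> g s @[s --> t] --> b ->
  f s * g s @[s --> t] --> a * b.
Proof. exact: cvgM. Qed.

(** Gronwall without integrals: under |g'| <= K g the function g e^(Kt) is
    nondecreasing and g e^(-Kt) is nonincreasing, so a zero of g >= 0 propagates
    in both directions. *)
Lemma gronwall_eq0_endpoints a b K g (dg : R -> R) :
  (forall t, t \in `[a, b] -> is_derive t 1 g (dg t)) ->
  (forall t, t \in `[a, b] -> 0 <= g t) ->
  (forall t, t \in `[a, b] -> `|dg t| <= K * g t) ->
  a <= b -> (g a = 0 <-> g b = 0).
Proof.
move=> gdg g0 dgK ab.
have oc (t : R) : t \in `]a, b[ -> t \in `[a, b] by exact: subset_itv_oo_cc.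
have aI : a \in `[a, b] by rewrite bound_itvE.
have bI : b \in `[a, b] by rewrite bound_itvE.
pose h (c : R) t := g t * expR (c * t).
have hdh c t : t \in `[a, b] -> is_derive t 1 (h c)
    ((dg t + c * g t) * expR (c * t)).
  move=> tab; have gt := gdg t tab.
  have et : is_derive t 1 (fun s => expR (c * s)) (expR (c * t) * c).
    have ct : is_derive t 1 (fun s : R => c * s) c.
      apply: is_derive_eq (@is_derive_mulf t (cst c) id 0 1 _ _) _.
      by rewrite mul0r add0r mulr1.
    exact: is_derive1_comp.
  by apply: is_derive_eq (is_derive_mulf gt et) _; ring.
have hc c : {within `[a, b], continuous (h c)}.
  by apply: derivable_within_continuous => t tab; case: (hdh c t tab).
have up : h K a <= h K b.
  apply: (@ger0_derive1_le_cc _ (h K) a b) => // t /oc tab.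
    by case: (hdh K t tab).
  rewrite derive1E; case: (hdh K t tab) => _ ->; rewrite pmulr_lge0 ?expR_gt0//.
  by have := dgK t tab; rewrite ler_norml; lra.
have down : h (- K) b <= h (- K) a.
  apply: (@ler0_derive1_le_cc _ (h (- K)) a b) => // t /oc tab.
    by case: (hdh (- K) t tab).
  rewrite derive1E; case: (hdh (- K) t tab) => _ ->.
  rewrite pmulr_lle0 ?expR_gt0//.
  by have := dgK t tab; rewrite ler_norml; lra.
split=> g00; apply/eqP; rewrite eq_le g0// andbT.
  by move: down; rewrite /h g00 mul0r pmulr_lle0 ?expR_gt0.
by move: up; rewrite /h g00 mul0r pmulr_lle0 ?expR_gt0.
Qed.

End PointwiseCalculus.

(** * The quaternion norm *)

Section QuaternionNorm.
Context {R : realType}.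
Implicit Types p q : quat R.

Lemma qreD p q : qre (p + q) = qre p + qre q. Proof. by []. Qed.
Lemma qim_iD p q : qim_i (p + q) = qim_i p + qim_i q. Proof. by []. Qed.
Lemma qim_jD p q : qim_j (p + q) = qim_j p + qim_j q. Proof. by []. Qed.
Lemma qim_kD p q : qim_k (p + q) = qim_k p + qim_k q. Proof. by []. Qed.

Definition qcoordD := (qreD, qim_iD, qim_jD, qim_kD).

Lemma qreM p q : qre (p * q) =
  qre p * qre q - qim_i p * qim_i q - qim_j p * qim_j q - qim_k p * qim_k q.
Proof. by case: p q => [????] [????]. Qed.

Lemma qim_iM p q : qim_i (p * q) =
  qre p * qim_i q + qim_i p * qre q + qim_j p * qim_k q - qim_k p * qim_j q.
Proof. by case: p q => [????] [????]. Qed.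

Lemma qim_jM p q : qim_j (p * q) =
  qre p * qim_j q - qim_i p * qim_k q + qim_j p * qre q + qim_k p * qim_i q.
Proof. by case: p q => [????] [????]. Qed.

Lemma qim_kM p q : qim_k (p * q) =
  qre p * qim_k q + qim_i p * qim_j q - qim_j p * qim_i q + qim_k p * qre q.
Proof. by case: p q => [????] [????]. Qed.

Definition qcoordM := (qreM, qim_iM, qim_jM, qim_kM).

Definition qdot p q : R :=
  qre p * qre q + qim_i p * qim_i q + qim_j p * qim_j q + qim_k p * qim_k q.

Definition qnorm2 q : R := qdot q q.

Lemma qnorm2_ge0 q : 0 <= qnorm2 q.
Proof. by rewrite /qnorm2 /qdot -!expr2 !addr_ge0 ?sqr_ge0. Qed.

Lemma qnorm2_eq0 q : qnorm2 q = 0 -> q = 0.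
Proof.
move=> /eqP; rewrite /qnorm2 /qdot -!expr2.
rewrite !paddr_eq0 ?addr_ge0 ?sqr_ge0// !sqrf_eq0.
by case: q => a b c d /= /andP[/andP[/andP[/eqP-> /eqP->] /eqP->] /eqP->].
Qed.

(** Euler's four-square identity. *)
Lemma qnorm2M p q : qnorm2 (p * q) = qnorm2 p * qnorm2 q.
Proof. by rewrite /qnorm2 /qdot !qcoordM; ring. Qed.

Lemma qdot_sumr (J : finType) p (F : J -> quat R) :
  qdot p (\sum_i F i) = \sum_i qdot p (F i).
Proof.
apply: (big_morph (qdot p)) => [u v|]; first by rewrite /qdot !qcoordD; ring.
by rewrite /qdot /= !mulr0 !addr0.
Qed.

(** Both signs come from expanding |p - q|^2 >= 0 and |p + q|^2 >= 0. *)
Lemma qdot_young p q : `|2 * qdot p q| <= qnorm2 p + qnorm2 q.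
Proof.
have /= := qnorm2_ge0 (p + q).
have : 0 <= qnorm2 (p - q) by exact: qnorm2_ge0.
rewrite /qnorm2 /qdot /= ler_norml => h1 h2; apply/andP; split; nra.
Qed.

End QuaternionNorm.

(** * Derivatives of quaternionic functions and matrices *)

Section QuaternionDerive.
Context {R : realType}.
Implicit Types (q : quat R) (f g : R -> quat R) (t : R).

Lemma is_qderive_cst t q : is_qderive t (fun=> q) 0.
Proof. by split; apply: is_derive_cst. Qed.

Lemma is_qderiveD t f g df dg : is_qderive t f df -> is_qderive t g dg ->
  is_qderive t (fun s => f s + g s) (df + dg).
Proof. by move=> [????] [????]; split; apply: is_deriveD. Qed.

Lemma is_qderiveN t f df :
  is_qderive t f df -> is_qderive t (fun s => - f s) (- df).
Proof. by case=> ????; split; apply: is_deriveN. Qed.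

Lemma is_qderiveM t f g df dg : is_qderive t f df -> is_qderive t g dg ->
  is_qderive t (fun s => f s * g s) (df * g t + f t * dg).
Proof.
move=> [f1 f2 f3 f4] [g1 g2 g3 g4].
split; [under eq_fun do rewrite qreM | under eq_fun do rewrite qim_iM
       | under eq_fun do rewrite qim_jM | under eq_fun do rewrite qim_kM];
  by apply: is_derive_eq; rewrite qcoordD !qcoordM /GRing.scale /=; ring.
Qed.

Lemma is_qderive_sum t (J : finType) (F : J -> R -> quat R) (dF : J -> quat R) :
  (forall i, is_qderive t (F i) (dF i)) ->
  is_qderive t (fun s => \sum_i F i s) (\sum_i dF i).
Proof.
move=> FdF.
have : forall r : seq J,
    is_qderive t (fun s => \sum_(i <- r) F i s) (\sum_(i <- r) dF i).
  elim=> [|i r IH].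
    by under eq_fun do rewrite big_nil; rewrite big_nil; exact: is_qderive_cst.
  by under eq_fun do rewrite big_cons; rewrite big_cons; exact: is_qderiveD.
exact.
Qed.

Lemma is_qderive_near t f g df : (\near t, f t = g t) ->
  is_qderive t f df -> is_qderive t g df.
Proof.
move=> fg [f1 f2 f3 f4]; split;
  [move: f1|move: f2|move: f3|move: f4];
  by apply: near_eq_is_derive; apply: filterS fg => s ->.
Qed.

Lemma is_derive_qdot t f g df dg : is_qderive t f df -> is_qderive t g dg ->
  is_derive t 1 (fun s => qdot (f s) (g s)) (qdot df (g t) + qdot (f t) dg).
Proof.
move=> [f1 f2 f3 f4] [g1 g2 g3 g4].
by rewrite /qdot; apply: is_derive_eq; rewrite /GRing.scale /=; ring.
Qed.

Lemma is_mxderive_cst (m n : nat) t (Q : 'M[quat R]_(m, n)) :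
  is_mxderive t (fun=> Q) 0.
Proof. by move=> i j; rewrite mxE; exact: is_qderive_cst. Qed.

Lemma is_mxderiveD (m n : nat) t (F G : R -> 'M[quat R]_(m, n)) dF dG :
  is_mxderive t F dF -> is_mxderive t G dG ->
  is_mxderive t (fun s => F s + G s) (dF + dG).
Proof.
move=> FdF GdG i j; under eq_fun do rewrite mxE.
by rewrite mxE; exact: is_qderiveD.
Qed.

Lemma is_mxderiveN (m n : nat) t (F : R -> 'M[quat R]_(m, n)) dF :
  is_mxderive t F dF -> is_mxderive t (fun s => - F s) (- dF).
Proof.
move=> FdF i j; under eq_fun do rewrite mxE.
by rewrite mxE; exact: is_qderiveN.
Qed.

Lemma is_mxderiveM (m k n : nat) t (F : R -> 'M[quat R]_(m, k))
    (G : R -> 'M[quat R]_(k, n)) dF dG :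
  is_mxderive t F dF -> is_mxderive t G dG ->
  is_mxderive t (fun s => F s *m G s) (dF *m G t + F t *m dG).
Proof.
move=> FdF GdG i j; under eq_fun do rewrite mxE.
by rewrite !mxE -big_split /=; apply: is_qderive_sum => l; exact: is_qderiveM.
Qed.

Lemma is_mxderive_near (m n : nat) t (F G : R -> 'M[quat R]_(m, n)) dF :
  (\near t, F t = G t) -> is_mxderive t F dF -> is_mxderive t G dF.
Proof.
move=> FG FdF i j; apply: is_qderive_near (FdF i j).
by apply: filterS FG => s ->.
Qed.

End QuaternionDerive.

(** * Continuity of quaternionic functions *)

Section QuaternionContinuity.
Context {R : realType}.
Implicit Types (q : quat R) (f g : R -> quat R) (t : R).

(** Continuity for the topology of R^4, stated on the real components because
    that is the form in which integrals and determinants consume it. *)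
Definition is_qcontinuous t f : Prop :=
  [/\ qre (f s) @[s --> t] --> qre (f t),
      qim_i (f s) @[s --> t] --> qim_i (f t),
      qim_j (f s) @[s --> t] --> qim_j (f t) &
      qim_k (f s) @[s --> t] --> qim_k (f t)].

Lemma continuous_qcoord : [/\ continuous (@qre R), continuous (@qim_i R),
  continuous (@qim_j R) & continuous (@qim_k R)].
Proof.
have tc : continuous (@quat_tuple R) by exact: initial_continuous.
split => q.
- apply: (@continuous_comp _ _ _ (@quat_tuple R) (fun u => u.1.1.1)).
    exact: tc.
  exact: (cvg_comp _ _ (cvg_comp _ _ cvg_fst cvg_fst) cvg_fst).
- apply: (@continuous_comp _ _ _ (@quat_tuple R) (fun u => u.1.1.2)).
    exact: tc.
  exact: (cvg_comp _ _ (cvg_comp _ _ cvg_fst cvg_fst) cvg_snd).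
- apply: (@continuous_comp _ _ _ (@quat_tuple R) (fun u => u.1.2)).
    exact: tc.
  exact: (cvg_comp _ _ cvg_fst cvg_snd).
- apply: (@continuous_comp _ _ _ (@quat_tuple R) (fun u => u.2)).
    exact: tc.
  exact: cvg_snd.
Qed.

Lemma continuous_mx_entry (T : topologicalType) (m n : nat) i j :
  continuous (fun M : 'M[T]_(m, n) => M i j).
Proof.
move=> M P MP; exists (fun i' j' => if (i' == i) && (j' == j) then P else setT).
  by move=> i' j'; case: ifP => [/andP[/eqP-> /eqP->]|_] //; exact: filterT.
by move=> N /= /(_ i j); rewrite !eqxx.
Qed.

Lemma is_qcontinuous_mx_entry t (m n : nat) (F : R -> 'M[quat R]_(m, n)) i j :
  {for t, continuous F} -> is_qcontinuous t (fun s => F s i j).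
Proof.
move=> Ft; have Fij : F s i j @[s --> t] --> F t i j.
  apply: (@continuous_comp _ _ _ F (fun M => M i j)); first exact: Ft.
  exact: continuous_mx_entry.
have [c1 c2 c3 c4] := continuous_qcoord.
split; [apply: continuous_comp (c1 _)|apply: continuous_comp (c2 _)|
  apply: continuous_comp (c3 _)|apply: continuous_comp (c4 _)]; exact: Fij.
Qed.

Lemma is_qderive_qcontinuous t f df : is_qderive t f df -> is_qcontinuous t f.
Proof.
have dc (h : R -> R) dh : is_derive t 1 h dh -> h @ t --> h t.
  by case=> ht _; exact/differentiable_continuous/derivable1_diffP.
by case=> f1 f2 f3 f4; split;
  [move: f1|move: f2|move: f3|move: f4] => /dc.
Qed.

Lemma is_qcontinuous_cst t q : is_qcontinuous t (fun=> q).
Proof. by split; exact: cvg_cst. Qed.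

Lemma is_qcontinuousD t f g : is_qcontinuous t f -> is_qcontinuous t g ->
  is_qcontinuous t (fun s => f s + g s).
Proof. by move=> [????] [????]; split; exact: cvgD. Qed.

Lemma is_qcontinuousM t f g : is_qcontinuous t f -> is_qcontinuous t g ->
  is_qcontinuous t (fun s => f s * g s).
Proof.
move=> [f1 f2 f3 f4] [g1 g2 g3 g4].
split; [under eq_fun do rewrite qreM | under eq_fun do rewrite qim_iM
       | under eq_fun do rewrite qim_jM | under eq_fun do rewrite qim_kM];
  rewrite qcoordM;
  [ apply: cvg_subf; [apply: cvg_subf; [apply: cvg_subf|]|]
  | apply: cvg_subf; [apply: cvg_addf; [apply: cvg_addf|]|]
  | apply: cvg_addf; [apply: cvg_addf; [apply: cvg_subf|]|]
  | apply: cvg_addf; [apply: cvg_subf; [apply: cvg_addf|]|]];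
  exact: cvg_mulf.
Qed.

Lemma is_qcontinuous_sum t (J : finType) (F : J -> R -> quat R) :
  (forall i, is_qcontinuous t (F i)) ->
  is_qcontinuous t (fun s => \sum_i F i s).
Proof.
move=> Ft.
have : forall r : seq J, is_qcontinuous t (fun s => \sum_(i <- r) F i s).
  elim=> [|i r IH].
    by under eq_fun do rewrite big_nil; exact: is_qcontinuous_cst.
  by under eq_fun do rewrite big_cons; exact: is_qcontinuousD.
exact.
Qed.

Lemma is_qcontinuous_near t f g : (\near t, f t = g t) ->
  is_qcontinuous t f -> is_qcontinuous t g.
Proof.
move=> fg; rewrite /is_qcontinuous -(nbhs_singleton fg).
by case=> f1 f2 f3 f4; split; [move: f1|move: f2|move: f3|move: f4];
  apply: cvg_trans; apply: near_eq_cvg; apply: filterS fg => s ->.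
Qed.

Lemma cvg_qnorm2 t f : is_qcontinuous t f ->
  qnorm2 (f s) @[s --> t] --> qnorm2 (f t).
Proof.
case=> ????; apply: cvg_addf; first apply: cvg_addf; first apply: cvg_addf;
  exact: cvg_mulf.
Qed.

End QuaternionContinuity.

(** * Uniqueness for the homogeneous system *)

Lemma sum_pairs (R : comPzRingType) (n : nat) (F : 'I_n -> R) (c : R) :
  \sum_j \sum_i (F j + F i * c) = (n%:R + n%:R * c) * \sum_j F j.
Proof.
under eq_bigr do rewrite big_split /= sumr_const -mulr_suml card_ord.
rewrite big_split /= sumr_const card_ord sumrMnl.
by rewrite -[X in X + _]mulr_natl -[X in _ + X]mulr_natl; ring.
Qed.

(** Nonsingularity on one side only; over a noncommutative field it cannot be
    read off a determinant of X itself. *)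
Definition left_cancellable (R : realType) (n : nat) (X : 'M[quat R]_n) : Prop :=
  forall q : 'rV[quat R]_n, q *m X = 0 -> q = 0.

Section HomogeneousSystem.
Context {R : realType} {n : nat} {I : set R}.
Hypotheses (I_open : open I) (I_itv : is_interval I).
Implicit Types (A X : R -> 'M[quat R]_n) (b x y : R -> 'rV[quat R]_n).

Lemma left_solutionD A b x y : left_solution I A b x ->
  left_solution I A (fun=> 0) y -> left_solution I A b (fun t => x t + y t).
Proof.
move=> xs ys t It; have := is_mxderiveD (xs t It) (ys t It).
by rewrite addr0 mulmxDl addrAC.
Qed.

Lemma is_mxderive_of_rows A X t :
  (forall i, left_solution I A (fun=> 0) (fun t => row i (X t))) ->
  I t -> is_mxderive t X (X t *m A t).
Proof.
move=> Xs It i j; have := Xs i t It 0 j; rewrite addr0 -row_mul mxE.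
by under eq_fun do rewrite mxE.
Qed.

(** Constants multiply on the left and A on the right, so left combinations of
    solutions are solutions although quaternions do not commute. *)
Lemma left_solution_combination A X (q : 'rV[quat R]_n) :
  (forall i, left_solution I A (fun=> 0) (fun t => row i (X t))) ->
  left_solution I A (fun=> 0) (fun t => q *m X t).
Proof.
move=> Xs t It.
have := is_mxderiveM (is_mxderive_cst t q) (is_mxderive_of_rows Xs It).
by rewrite mul0mx add0r addr0 mulmxA.
Qed.

Lemma homogeneous_solution_eq0 A x s t : {within I, continuous A} ->
  left_solution I A (fun=> 0) x -> I s -> I t -> x s = 0 -> x t = 0.
Proof.
move=> cA xs Is It xs0.
pose g u := \sum_j qnorm2 (x u 0 j).
pose y u := x u *m A u.
pose dg u := \sum_j 2 * qdot (x u 0 j) (y u 0 j).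
pose k u := \sum_i \sum_j qnorm2 (A u i j).
have g_eq0 (a b : R) : I a -> I b -> a <= b -> (g a = 0 <-> g b = 0).
  move=> Ia Ib ab.
  have abI u : u \in `[a, b] -> I u by rewrite in_itv /=; exact: I_itv.
  have ck : {within `[a, b], continuous k}.
    apply: continuous_in_subspaceT => u /[1!inE] /= uab.
    have cAu : {for u, continuous A}.
      move: cA; rewrite continuous_open_subspace//; apply; rewrite inE.
      exact: abI.
    apply: cvg_big => [|i _]; first exact: add_continuous.
    apply: cvg_big => [|j _]; first exact: add_continuous.
    exact/cvg_qnorm2/is_qcontinuous_mx_entry.
  have [c cab kc] := EVT_max ab ck.
  (* Each term 2 <x_j, x_i A_ij> is at most |x_j|^2 + |x_i|^2 |A_ij|^2 in
     absolute value; summing over i and j produces this constant. *)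
  apply: (@gronwall_eq0_endpoints _ a b (n%:R + n%:R * k c) g dg) => // u uab.
  - apply: is_derive_sumf => j; have := xs u (abI u uab) 0 j.
    rewrite addr0 => xj; apply: is_derive_eq (is_derive_qdot xj xj) _.
    by rewrite /qdot; ring.
  - by apply: sumr_ge0 => j _; exact: qnorm2_ge0.
  - have kA i j : qnorm2 (A u i j) <= k c.
      apply: le_trans (kc u uab).
      rewrite /k (bigD1 i)//= (bigD1 j)//= -addrA lerDl.
      rewrite addr_ge0// ?sumr_ge0// => [j' _|i' _]; first exact: qnorm2_ge0.
      by rewrite sumr_ge0// => j' _; exact: qnorm2_ge0.
    apply: (@le_trans _ _ (\sum_j \sum_i
        (qnorm2 (x u 0 j) + qnorm2 (x u 0 i) * k c))).
      apply: le_trans (ler_norm_sum _ _ _) _; apply: ler_sum => j _.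
      rewrite /y mxE qdot_sumr mulr_sumr.
      apply: le_trans (ler_norm_sum _ _ _) _; apply: ler_sum => i _.
      apply: le_trans (qdot_young _ _) _; rewrite qnorm2M lerD2l.
      by rewrite ler_wpM2l ?qnorm2_ge0.
    by rewrite sum_pairs.
have gs : g s = 0.
  by rewrite /g big1// => j _; rewrite xs0 mxE /qnorm2 /qdot /= !mulr0 !addr0.
have gt : g t = 0 by case: (leP s t) => [|/ltW] /g_eq0; [case|case]=> //; auto.
apply/rowP => j; rewrite mxE; apply: qnorm2_eq0; apply/eqP.
move: gt => /eqP; rewrite /g psumr_eq0 => [/allP|j' _]; last exact: qnorm2_ge0.
by apply; rewrite mem_index_enum.
Qed.

Lemma fundamental_left_cancellable A X s : {within I, continuous A} ->
  left_fundamental_matrix I A X -> I s -> left_cancellable (X s).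
Proof.
move=> cA [Xs Xfree] Is q qX0; apply/rowP => i; rewrite mxE.
apply: (Xfree (fun i => q 0 i)) => t It.
have qXs := left_solution_combination q Xs.
by have := homogeneous_solution_eq0 cA qXs Is It qX0; rewrite mulmx_sum_row.
Qed.

End HomogeneousSystem.

(** * Inverting quaternionic matrices through their real form *)

Section RealForm.
Context {R : realType} {n : nat}.
Implicit Types (u v : 'rV[quat R]_n) (M N : 'M[R]_(4, n)) (X Y : 'M[quat R]_n).

Definition real_of u : 'M[R]_(4, n) :=
  \matrix_(c, j) [:: qre (u 0 j); qim_i (u 0 j); qim_j (u 0 j); qim_k (u 0 j)]`_c.

Definition quat_of M : 'rV[quat R]_n :=
  \row_j Quat (M 0 j) (M 1 j) (M 2 j) (M 3 j).

Lemma real_ofK : cancel real_of quat_of.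
Proof. by move=> u; apply/rowP => j; rewrite !mxE /=; case: (u 0 j). Qed.

Lemma quat_ofK : cancel quat_of real_of.
Proof.
move=> M; apply/matrixP => c j; rewrite !mxE.
by case: c => [[|[|[|[|c]]]] lt_c4] //=; congr (M _ j); apply: val_inj.
Qed.

Definition qscalar (a : R) : quat R := Quat a 0 0 0.

Lemma quat_of_linear a M N :
  quat_of (a *: M + N) = qscalar a *: quat_of M + quat_of N.
Proof. by apply/rowP => j; rewrite !mxE; congr Quat => /=; ring. Qed.

Lemma real_of_linear a u v :
  real_of (qscalar a *: u + v) = a *: real_of u + real_of v.
Proof. by apply: (can_inj quat_ofK); rewrite quat_of_linear !real_ofK. Qed.

Definition real_mulmx X M : 'M[R]_(4, n) := real_of (quat_of M *m X).

Fact real_mulmx_linear X : linear (real_mulmx X).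
Proof.
move=> a M N; rewrite /real_mulmx quat_of_linear mulmxDl -scalemxAl.
exact: real_of_linear.
Qed.

HB.instance Definition _ X := GRing.isLinear.Build R _ _ _ (real_mulmx X)
  (real_mulmx_linear X).

Definition real_form X : 'M[R]_(4 * n) := lin_mx (real_mulmx X).

Lemma real_formE X u :
  mxvec (real_of u) *m real_form X = mxvec (real_of (u *m X)).
Proof. by rewrite mul_vec_lin /= /real_mulmx real_ofK. Qed.

(** An injective endomorphism of a finite-dimensional real space is bijective. *)
Lemma real_form_unit X : left_cancellable X -> real_form X \in unitmx.
Proof.
move=> Xinj; rewrite -row_free_unit; apply: inj_row_free => w.
rewrite -[w]vec_mxK -[vec_mx w]quat_ofK real_formE.
have real0 : real_of 0 = 0.
  by apply: (can_inj quat_ofK); rewrite real_ofK; apply/rowP => j; rewrite !mxE.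
move=> /(canRL mxvecK); rewrite linear0 -real0 => /(can_inj real_ofK) /Xinj ->.
by rewrite real0 linear0.
Qed.

(** The i-th row is the preimage of the i-th unit vector under right
    multiplication by X.  Cramer's formula replaces [invmx], so that this is a
    single expression in the entries of X, with no case distinction. *)
Definition qinv_cramer X : 'M[quat R]_n :=
  \matrix_i quat_of (vec_mx (mxvec (real_of (row i 1%:M)) *m
    ((\det (real_form X))^-1 *: \adj (real_form X)))).

Lemma qinv_cramerP X : left_cancellable X -> is_qinvmx X (qinv_cramer X).
Proof.
move=> Xinj; have Xu := real_form_unit Xinj.
have YX : qinv_cramer X *m X = 1%:M.
  apply/row_matrixP => i; rewrite row_mul rowK.
  apply: (can_inj real_ofK); apply: (can_inj mxvecK).
  rewrite -real_formE quat_ofK vec_mxK.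
  have -> : (\det (real_form X))^-1 *: \adj (real_form X) = invmx (real_form X).
    by rewrite /invmx Xu.
  by rewrite -mulmxA mulVmx// mulmx1.
(* A left inverse is a right inverse: (XY - 1)X = X(YX) - X = 0 and X cancels. *)
split=> //; apply/eqP; rewrite -subr_eq0; apply/eqP/row_matrixP => i.
rewrite row0; apply: Xinj.
by rewrite -row_mul mulmxBl -mulmxA YX mulmx1 mul1mx subrr row0.
Qed.

Lemma is_qinvmx_unique X Y Y' : is_qinvmx X Y -> is_qinvmx X Y' -> Y = Y'.
Proof. by move=> [XY YX] [XY' _]; rewrite -[Y]mulmx1 -XY' mulmxA YX mul1mx. Qed.

Lemma qinvmxP X : qunitmx X -> is_qinvmx X (qinvmx X).
Proof. by move=> XU; apply: (xgetPex 0 XU). Qed.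

Lemma qmulVmx X : qunitmx X -> qinvmx X *m X = 1%:M.
Proof. by case/qinvmxP. Qed.

End RealForm.

(** * Continuity of the inverse *)

Section InverseContinuity.
Context {R : realType}.
Implicit Type t : R.

Lemma cvg_det t (m : nat) (F : R -> 'M[R]_m) :
  (forall i j, F s i j @[s --> t] --> F t i j) ->
  \det (F s) @[s --> t] --> \det (F t).
Proof.
move=> Ft; apply: cvg_big => [|u _]; first exact: add_continuous.
apply: cvg_mulf; first exact: cvg_cst.
by apply: cvg_big => [|i _]; [exact: mul_continuous|exact: Ft].
Qed.

Lemma cvg_cramer t (m : nat) (F : R -> 'M[R]_m) i j :
  (forall i j, F s i j @[s --> t] --> F t i j) -> F t \in unitmx ->
  ((\det (F s))^-1 *: \adj (F s)) i j @[s --> t] -->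
    ((\det (F t))^-1 *: \adj (F t)) i j.
Proof.
move=> Ft Fu; rewrite mxE; under eq_fun do rewrite mxE.
apply: cvg_mulf.
  by apply: cvgV; [move: Fu; rewrite unitmxE unitfE|exact: cvg_det].
rewrite mxE; under eq_fun do rewrite mxE.
apply: cvg_mulf; first exact: cvg_cst.
apply: cvg_det => i' j'; rewrite !mxE; under eq_fun do rewrite !mxE.
exact: Ft.
Qed.

Lemma is_qcontinuous_qinvmx (n : nat) (X : R -> 'M[quat R]_n) t :
  (forall i j, is_qcontinuous t (fun s => X s i j)) ->
  (\forall s \near t, left_cancellable (X s)) ->
  forall i j, is_qcontinuous t (fun s => qinvmx (X s) i j).
Proof.
move=> Xt Xinj i j.
have XE : \forall s \near t, qinv_cramer (X s) = qinvmx (X s).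
  apply: filterS Xinj => s Xs.
  by apply: is_qinvmx_unique (qinvmxP _); [|exists (qinv_cramer (X s))];
    exact: qinv_cramerP.
have Cij k l : ((\det (real_form (X s)))^-1 *: \adj (real_form (X s))) k l
    @[s --> t] -->
    ((\det (real_form (X t)))^-1 *: \adj (real_form (X t))) k l.
  apply: cvg_cramer => [{}k {}l|]; last first.
    exact/real_form_unit/(nbhs_singleton Xinj).
  (* An entry of the real form is a real component of an entry of u X(s) for a
     constant row u, the quaternionic form of a unit vector. *)
  rewrite /real_form /lin_mx /lin1_mx; under eq_fun do rewrite mxE.
  rewrite mxE /=; case/mxvec_indexP: l => c l.
  under eq_fun do rewrite mxvecE /real_mulmx mxE.
  rewrite mxvecE /real_mulmx mxE.
  set u := quat_of _.
  have [? ? ? ?] : is_qcontinuous t (fun s => (u *m X s) 0 l).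
    under eq_fun do rewrite mxE; apply: is_qcontinuous_sum => h.
    by apply: is_qcontinuousM; [exact: is_qcontinuous_cst|exact: Xt].
  by case: c => [[|[|[|[|c]]]] lt_c4].
apply: (@is_qcontinuous_near _ t (fun s => qinv_cramer (X s) i j)).
  by apply: filterS XE => s ->.
pose W s := vec_mx (mxvec (real_of (row i 1%:M)) *m
    ((\det (real_form (X s)))^-1 *: \adj (real_form (X s)))) : 'M[R]_(4, n).
have Wt c : W s c j @[s --> t] --> W t c j.
  rewrite /W; under eq_fun do rewrite mxE mxE.
  rewrite mxE mxE.
  apply: cvg_big => [|k _]; first exact: add_continuous.
  by apply: cvg_mulf; [exact: cvg_cst|exact: Cij].
have WE s : qinv_cramer (X s) i j =
    Quat (W s 0 j) (W s 1 j) (W s 2 j) (W s 3 j) by rewrite !mxE.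
by split; under eq_fun do rewrite WE; rewrite WE; exact: Wt.
Qed.

End InverseContinuity.

(** * The fundamental theorem of calculus for oriented integrals *)

Section OrientedIntegral.
Context {R : realType}.
Notation mu := (@lebesgue_measure R).
Implicit Types (f : R -> R) (a b x y : R).

Lemma oriented_integralxx a f : oriented_integral a a f = 0.
Proof. by rewrite /oriented_integral lexx set_itv1 Rintegral_set1. Qed.

(** With a base point below both bounds the sign convention disappears, which
    reduces differentiation on either side of x to integrals over [a, y]. *)
Lemma oriented_integralE a b x y f : mu.-integrable `[a, b] (EFin \o f) ->
  x \in `[a, b] -> y \in `[a, b] ->
  oriented_integral x y f =
  \int[mu]_(s in `[a, y]) f s - \int[mu]_(s in `[a, x]) f s.
Proof.
move=> fi; rewrite !in_itv /= => /andP[ax xb] /andP[ay yb].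
have int_le u v : a <= u -> u <= v -> v <= b ->
    \int[mu]_(s in `[u, v]) f s =
    \int[mu]_(s in `[a, v]) f s - \int[mu]_(s in `[a, u]) f s.
  move=> au uv vb.
  have fiv : mu.-integrable `[a, v] (EFin \o f).
    by apply: integrableS fi => //; apply: subset_itvl; rewrite bnd_simp.
  rewrite Rintegral_itvB ?bnd_simp// Rintegral_itv_obnd_cbnd//.
  by apply: integrableS fiv => //; apply: subset_itvr; rewrite bnd_simp.
rewrite /oriented_integral; case: ifPn => [xy|]; first exact: int_le.
by rewrite -ltNge => /ltW yx; rewrite int_le// opprB.
Qed.

Lemma open_exists_lt (I : set R) x : open I -> I x -> exists2 a, a < x & I a.
Proof.
move=> /[apply] /nbhs_ballP[e /= e0 xe]; exists (x - e / 2).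
  by rewrite gtrBl divr_gt0.
apply: xe; rewrite /ball /= opprB addrC subrK gtr0_norm ?divr_gt0//.
by rewrite ltr_pdivrMr// ltr_pMr// ltr1n.
Qed.

Lemma open_exists_gt (I : set R) x : open I -> I x -> exists2 b, x < b & I b.
Proof.
move=> /[apply] /nbhs_ballP[e /= e0 xe]; exists (x + e / 2).
  by rewrite ltrDl divr_gt0.
apply: xe; rewrite /ball /= opprD addrA subrr sub0r normrN.
by rewrite gtr0_norm ?divr_gt0// ltr_pdivrMr// ltr_pMr// ltr1n.
Qed.

Lemma is_derive_oriented_integral (I : set R) f x y :
  open I -> is_interval I -> (forall s, I s -> f @ s --> f s) ->
  I x -> I y -> is_derive y 1 (fun u => oriented_integral x u f) (f y).
Proof.
move=> oI iI cf Ix Iy.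
have [a axy Ia] : exists2 a, a < Num.min x y & I a.
  by apply: open_exists_lt => //; case: (leP x y).
have [b bxy Ib] : exists2 b, Num.max x y < b & I b.
  by apply: open_exists_gt => //; case: (leP x y).
move: axy bxy; rewrite lt_min gt_max => /andP[ax ay] /andP[xb yb].
have fi : mu.-integrable `[a, b] (EFin \o f).
  apply: continuous_compact_integrable; first exact: segment_compact.
  apply: continuous_in_subspaceT => s /[1!inE] /= sab; apply: cf.
  by apply: (iI a b) => //; move: sab; rewrite in_itv.
have Fd : is_derive y 1 (fun u => \int[mu]_(s in `[a, u]) f s -
    \int[mu]_(s in `[a, x]) f s) (f y).
  have [dF Ff] := continuous_FTC1_closed yb fi ay (cf y Iy).
  exact: is_derive1_subc.
apply: near_eq_is_derive Fd.
have yab : y \in `]a, b[ by rewrite in_itv /= ay yb.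
near=> u.
have uab : u \in `]a, b[ by near: u; exact: near_in_itvoo.
rewrite (@oriented_integralE a b) ?(subset_itv_oo_cc uab)//.
by rewrite in_itv /= !ltW.
Unshelve. all: by end_near. Qed.

Lemma mxintegralxx (m n : nat) a (F : R -> 'M[quat R]_(m, n)) :
  mxintegral a a F = 0.
Proof.
by apply/matrixP => i j; rewrite !mxE /qintegral !oriented_integralxx.
Qed.

Lemma is_mxderive_mxintegral (m n : nat) (I : set R) x y
    (F : R -> 'M[quat R]_(m, n)) :
  open I -> is_interval I ->
  (forall s i j, I s -> is_qcontinuous s (fun u => F u i j)) ->
  I x -> I y -> is_mxderive y (fun u => mxintegral x u F) (F y).
Proof.
move=> oI iI cF Ix Iy i j; under eq_fun do rewrite mxE.
by split; apply: (@is_derive_oriented_integral I) => // s Is;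
  case: (cF s i j Is).
Qed.

End OrientedIntegral.

(** * Variation of constants *)

Unset Implicit Arguments.

Theorem theorem3p8 (R : realType) (n : nat) (I : set R)
    (hI_open : open I) (hI_itv : is_interval I)
    (A : R -> 'M[quat R]_n) (b : R -> 'rV[quat R]_n)
    (hA : {within I, continuous A}) (hb : {within I, continuous b})
    (X : R -> 'M[quat R]_n) (hX : left_fundamental_matrix I A X)
    (t0 : R) (ht0 : I t0) :
  (forall s, I s -> qunitmx (X s)) /\
  (forall x : R -> 'rV[quat R]_n,
     left_solution I A b x <->
     exists q : 'rV[quat R]_n, forall t, I t ->
       x t = q *m X t
             + mxintegral t0 t (fun s => b s *m qinvmx (X s)) *m X t).
Proof.
have Xinj s : I s -> left_cancellable (X s).
  exact: (fundamental_left_cancellable hI_open hI_itv hA hX).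
have XU s : I s -> qunitmx (X s).
  by move=> /Xinj /qinv_cramerP ?; exists (qinv_cramer (X s)).
split=> // x; have [Xs _] := hX.
have nI t : I t -> \forall s \near t, I s by exact: hI_open.
pose w s := b s *m qinvmx (X s).
have cw s i j : I s -> is_qcontinuous s (fun u => w u i j).
  move=> Is; under eq_fun do rewrite mxE; apply: is_qcontinuous_sum => k.
  apply: is_qcontinuousM.
    apply: is_qcontinuous_mx_entry; move: hb.
    by rewrite continuous_open_subspace//; apply; rewrite inE.
  apply: is_qcontinuous_qinvmx => [i' j'|].
    exact: (is_qderive_qcontinuous (is_mxderive_of_rows Xs Is i' j')).
  by apply: filterS (nI s Is) => u; exact: Xinj.
pose p t := mxintegral t0 t w *m X t.
have ps : left_solution I A b p.
  move=> t It; have dW := is_mxderive_mxintegral hI_open hI_itv cw ht0 It.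
  have := is_mxderiveM dW (is_mxderive_of_rows Xs It).
  rewrite /w -[_ *m qinvmx _ *m _]mulmxA (qmulVmx (XU t It)) mulmx1.
  by rewrite mulmxA addrC.
have p0 : p t0 = 0 by rewrite /p mxintegralxx mul0mx.
split=> [xs|[q xq] t It].
  pose q := x t0 *m qinvmx (X t0); exists q => t It.
  pose z s := x s + (- p s) + (- q) *m X s.
  have zs : left_solution I A (fun=> 0) z.
    apply: left_solutionD => [s Is|]; last exact: left_solution_combination.
    have := is_mxderiveD (xs s Is) (is_mxderiveN (ps s Is)).
    by rewrite addr0 mulmxDl mulNmx opprD addrACA subrr addr0.
  have z0 : z t0 = 0.
    by rewrite /z /q p0 mulNmx -mulmxA (qmulVmx (XU t0 ht0)) mulmx1 subr0 subrr.
  have := homogeneous_solution_eq0 hI_open hI_itv hA zs ht0 It z0.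
  by rewrite /z mulNmx => /eqP; rewrite subr_eq0 subr_eq => /eqP.
have := left_solutionD ps (left_solution_combination q Xs) It.
rewrite (xq t It) [_ *m X t + _]addrC; apply: is_mxderive_near.
by apply: filterS (nI t It) => s /xq ->; rewrite addrC.
Qed.
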